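(* Let $A$ be a finite-dimensional simple Novikov algebra over $\mathbb{R}$. Then $A$ is isomorphic to either $A_{2,\mathbb{R}}$ or the field $\mathbb{R}$.
   Context: A left-symmetric algebra over $\mathbb{R}$ is a real vector space $A$ with a bilinear product $\cdot$ such that $(x\cdot y)\cdot z-x\cdot(y\cdot z)=(y\cdot x)\cdot z-y\cdot(x\cdot z)$ for all $x,y,z\in A$; it is a Novikov algebra if moreover $(x\cdot y)\cdot z=(x\cdot z)\cdot y$ for all $x,y,z\in A$. An algebra $A$ is simple if it is nonzero, has no two-sided ideal other than $\{0\}$ and $A$, and is not the one-dimensional algebra with zero product. $A_{2,\mathbb{R}}$ is the two-dimensional commutative real algebra with basis $e_1,e_2$ and products $e_1\cdot e_1=e_1$, $e_1\cdot e_2=e_2\cdot e_1=e_2$, $e_2\cdot e_2=-e_1$. *)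

(* Defs.v *)
From HB Require Import structures.
From mathcomp Require Import all_boot all_order all_algebra.
From mathcomp Require Import reals.

Set Implicit Arguments.
Unset Strict Implicit.
Unset Printing Implicit Defensive.

Import GRing.Theory.
Local Open Scope ring_scope.

(* An algebra is a vector space together with a product; [vectType] makes the
   space finite-dimensional. *)
Section Algebras.
Variables (R : fieldType) (A : vectType R) (mul : A -> A -> A).

Definition left_symmetric : Prop := forall x y z : A,
  mul (mul x y) z - mul x (mul y z) = mul (mul y x) z - mul y (mul x z).

Definition novikov : Prop :=
  left_symmetric /\ forall x y z : A, mul (mul x y) z = mul (mul x z) y.

Definition two_sided_ideal (I : {vspace A}) : Prop :=
  forall x y : A, y \in I -> mul x y \in I /\ mul y x \in I.

Definition simple_algebra : Prop :=
  [/\ exists x : A, x != 0,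
      forall I : {vspace A}, two_sided_ideal I -> I = 0%VS \/ I = fullv
    & ~ (\dim {:A} = 1%N /\ forall x y : A, mul x y = 0)].

End Algebras.

Definition algebra_isomorphic (R : fieldType) (A B : vectType R)
    (mulA : A -> A -> A) (mulB : B -> B -> B) : Prop :=
  exists2 f : {linear A -> B}, bijective f &
    forall x y : A, f (mulA x y) = mulB (f x) (f y).

Section A2.
Variable R : realType.

Definition A2_e1 : 'rV[R]_2 := delta_mx 0 0.
Definition A2_e2 : 'rV[R]_2 := delta_mx 0 1.

Definition A2_table (i j : 'I_2) : 'rV[R]_2 :=
  if i == 0 then (if j == 0 then A2_e1 else A2_e2)
  else (if j == 0 then A2_e2 else - A2_e1).

(* the bilinear extension of the multiplication table of the basis *)
Definition A2_mul (x y : 'rV[R]_2) : 'rV[R]_2 :=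
  \sum_(i < 2) \sum_(j < 2) (x 0 i * y 0 j) *: A2_table i j.

Fact A2_mul_is_bilinear : bilinear_for *:%R *:%R A2_mul.
Proof.
split=> [y|x] a u v; rewrite /A2_mul /= scaler_sumr -big_split /=;
  apply: eq_bigr => i _; rewrite scaler_sumr -big_split /=;
  apply: eq_bigr => j _; rewrite !mxE scalerA -scalerDl.
- by rewrite mulrDl mulrA.
- by rewrite mulrDr mulrCA.
Qed.

HB.instance Definition _ := bilinear_isBilinear.Build R _ _ _ _ _ A2_mul
  A2_mul_is_bilinear.

Lemma A2_mul_delta (i j : 'I_2) :
  A2_mul (delta_mx 0 i) (delta_mx 0 j) = A2_table i j.
Proof.
rewrite /A2_mul (bigD1 i) //= (bigD1 j) //= !mxE !eqxx mulr1 scale1r.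
rewrite [X in _ + X + _]big1 => [|k /negPf nkj]; last first.
  by rewrite !mxE nkj mulr0 scale0r.
rewrite addr0 big1 ?addr0 // => l /negPf nli.
by rewrite big1 // => k _; rewrite !mxE nli mul0r scale0r.
Qed.

Lemma A2_mulE :
  [/\ A2_mul A2_e1 A2_e1 = A2_e1, A2_mul A2_e1 A2_e2 = A2_e2,
      A2_mul A2_e2 A2_e1 = A2_e2 & A2_mul A2_e2 A2_e2 = - A2_e1].
Proof. by split; rewrite A2_mul_delta. Qed.

End A2.

(* the field R as an algebra over itself *)
Definition field_mul (R : fieldType) (x y : R^o) : R^o := x * y.

(* Main.v *)
(* The right multiplications R_z commute, and left symmetry gives
   [L_y, R_z] = R_(yz) - R_z R_y, so bracketing with L_y maps the double
   centralizer C of the R_z, a commutative algebra, into itself. For c in C the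
   stable image of the powers of c is therefore an ideal, so c is invertible or
   nilpotent. A bracket [L_y, c] is not invertible, by a trace argument, hence it
   is nilpotent; so the common kernel of the nilpotent elements of C is an ideal.
   It is nonzero, hence everything: every nonzero element of C is invertible and
   every [L_y, c] vanishes. Thus A is associative, then commutative, hence a
   field, and every x in A satisfies a real equation (x - a)^2 = - b^2 because
   R_x has a complex eigenvalue. *)

From HB Require Import structures.
Require Import Defs.
From mathcomp Require Import all_boot all_order all_algebra.
From mathcomp Require Import reals.
From mathcomp Require Import boolp complex ring.

Set Implicit Arguments.
Unset Strict Implicit.
Unset Printing Implicit Defensive.

Import Order.TTheory GRing.Theory Num.Theory passmx.
Local Open Scope ring_scope.

(** * Subspaces and stable images of endomorphisms *)

Section VectorSpaces.
Variables (F : fieldType) (V : vectType F).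
Implicit Types (U W : {vspace V}) (f g h : 'End(V)).

Lemma ex_dimv_min (P : {vspace V} -> Prop) U :
  P U -> exists2 W, P W & forall W', P W' -> (\dim W <= \dim W')%N.
Proof.
move=> PU; have exP : exists n, `[< exists2 W, P W & \dim W = n >].
  by exists (\dim U); apply/asboolP; exists U.
case: (ex_minnP exP) => n /asboolP[W PW <-] minW; exists W => // W' PW'.
by apply: minW; apply/asboolP; exists W'.
Qed.

(** A subspace inside [P] of maximal dimension contains every [v] satisfying [P], since adding the
    line of [v] stays inside [P]. *)
Lemma vspace_of_pred (P : V -> Prop) :
    P 0 -> (forall a u v, P u -> P v -> P (a *: u + v)) ->
  exists W, forall v, v \in W <-> P v.
Proof.
move=> P0 PD; pose Q W := forall v, v \in W -> P v.
have exQ : exists n, `[< exists2 W, Q W & \dim W = n >].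
  exists 0%N; apply/asboolP; exists 0%VS; rewrite ?dimv0 //.
  by move=> v /[!memv0]/eqP->.
have boundQ n : `[< exists2 W, Q W & \dim W = n >] -> (n <= \dim {:V})%N.
  by move=> /asboolP[W _ <-]; rewrite dimvS ?subvf.
case: (ex_maxnP exQ boundQ) => n /asboolP[W QW <-] maxW; exists W => v.
split=> [|Pv]; first exact: QW.
have QWv : Q (W + <[v]>)%VS.
  move=> _ /memv_addP[w Ww [_ /vlineP[a ->] ->]].
  by rewrite addrC; apply: PD => //; apply: QW.
have /maxW leW : `[< exists2 U, Q U & \dim U = \dim (W + <[v]>) >].
  by apply/asboolP; exists (W + <[v]>)%VS.
have /eqP -> : W == (W + <[v]>)%VS by rewrite eqEdim addvSl.
by rewrite memvE addvSr.
Qed.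

Lemma dim_fullv_gt0 (x : V) : x != 0 -> (0 < \dim {:V})%N.
Proof.
move=> x0; rewrite lt0n dimv_eq0.
by apply: contraNneq x0 => V0; rewrite -memv0 -V0 memvf.
Qed.

Lemma limg_full_lker0 f : limg f = fullv -> lker f == 0%VS.
Proof.
move=> fT; have := limg_ker_dim f fullv.
by rewrite fT capfv -[RHS]add0n => /addIn/eqP; rewrite dimv_eq0.
Qed.

(* Fitting's stable image: the images of the iterates of [f] decrease, hence
   stabilize at a subspace on which [f] is surjective. *)
Definition img_iter f k : {vspace V} := iter k (lfun_img f) fullv.

Lemma img_iterS f k : (img_iter f k.+1 <= img_iter f k)%VS.
Proof. by elim: k => [|k IHk]; [exact: subvf | exact: limgS]. Qed.

Lemma img_iter_stable f : exists k, (f @: img_iter f k)%VS = img_iter f k.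
Proof.
have [|_ [k ->] mink] := @ex_dimv_min (fun W => exists k, W = img_iter f k) fullv.
  by exists 0%N.
exists k; apply/eqP; rewrite eqEdim img_iterS /= mink //.
by exists k.+1.
Qed.

Lemma img_iter_comm f g k v :
  (f \o g = g \o f)%VF -> v \in img_iter f k -> g v \in img_iter f k.
Proof.
move=> fgC; elim: k v => [|k IHk] v; first by rewrite !memvf.
move=> /memv_imgP[u Uu ->]; rewrite -comp_lfunE -fgC comp_lfunE.
exact/memv_img/IHk.
Qed.

(** Here [g] costs one power of [f]: inductively, $g f^{k+1} = f^{k+1} g + (k+1) f^k d$. *)
Lemma img_iter_derivation f g d k v :
    (g \o f = f \o g + d)%VF -> (f \o d = d \o f)%VF ->
  v \in img_iter f k.+1 -> g v \in img_iter f k.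
Proof.
move=> gfE fdC; elim: k v => [|k IHk] v; first by rewrite memvf.
move=> /memv_imgP[u Uu ->]; rewrite -comp_lfunE gfE add_lfunE comp_lfunE.
by rewrite memvD //; [exact/memv_img/IHk | exact: (@img_iter_comm f d k.+1)].
Qed.

Lemma sub_img_iter f k U : (f @: U)%VS = U -> (U <= img_iter f k)%VS.
Proof.
by move=> fU; elim: k => [|k IHk]; rewrite ?subvf // -fU; apply: limgS.
Qed.

End VectorSpaces.

(* If [d = g f - f g] were invertible, then [d^-1] would commute with [f], so
   that [1 = [g, f] d^-1 = [g d^-1, f]] would have trace [0]. *)
Lemma commutator_not_onto (F : numFieldType) (V : vectType F)
    (f g d : 'End(V)) :
    (0 < \dim {:V})%N ->
    (g \o f = f \o g + d)%VF -> (f \o d = d \o f)%VF ->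
  limg d != fullv.
Proof.
move=> V_gt0 gfE fdC; apply/eqP => /limg_full_lker0 kerd.
have fdVC : (f \o d^-1 = d^-1 \o f)%VF.
  by rewrite -[LHS](lker0_compKf kerd) (comp_lfunA d) -fdC lker0_compfK.
pose e := vbasis {:V}; have eV : basis_of {:V} e by exact: vbasisP.
have tr_comm (p q : 'End(V)) :
    \tr (mxof e e (p \o q)%VF) = \tr (mxof e e (q \o p)%VF).
  by rewrite !(mxof_comp _ _ eV) mxtrace_mulC.
have : \tr (mxof e e \1%VF) = 0.
  rewrite -(lker0_compfV kerd).
  have -> : (d \o d^-1 = (g \o d^-1 \o f) - (f \o (g \o d^-1)))%VF.
    rewrite -(comp_lfunA g) -fdVC (comp_lfunA g) gfE comp_lfunDl.
    by rewrite (comp_lfunA f) addrC addKr.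
  by rewrite linearB /= linearB /= tr_comm subrr.
rewrite mxof1 ?(basis_free eV) // mxtrace1 => /eqP.
by rewrite pnatr_eq0 -leqn0 leqNgt V_gt0.
Qed.

(** * Double centralizers of commuting families *)

Section DoubleCentralizer.
Variables (F : fieldType) (V : vectType F) (S : 'End(V) -> Prop).
Hypothesis S_comm : forall f g, S f -> S g -> (f \o g = g \o f)%VF.

Definition centralizes (f : 'End(V)) := forall g, S g -> (f \o g = g \o f)%VF.

Definition bicentralizes (f : 'End(V)) :=
  forall g, centralizes g -> (f \o g = g \o f)%VF.

Lemma sub_bicentralizes f : S f -> bicentralizes f.
Proof. by move=> Sf g /(_ f Sf). Qed.

(** As [S] is commutative, it lies in its centralizer, so its double centralizer does too. *)
Lemma bicentralizes_comm f g :
  bicentralizes f -> bicentralizes g -> (f \o g = g \o f)%VF.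
Proof. by move=> Cf Cg; apply/Cf => h Sh; apply: Cg => k Sk; apply: S_comm. Qed.

Lemma bicentralizesB f g :
  bicentralizes f -> bicentralizes g -> bicentralizes (f - g).
Proof.
move=> Cf Cg h Ch; rewrite comp_lfunDl comp_lfunDr comp_lfunNl comp_lfunNr.
by rewrite Cf // Cg.
Qed.

Lemma bicentralizes_comp f g :
  bicentralizes f -> bicentralizes g -> bicentralizes (f \o g)%VF.
Proof.
by move=> Cf Cg h Ch; rewrite -comp_lfunA Cg // comp_lfunA Cf // comp_lfunA.
Qed.

(* Jacobi identity: if [ad g] maps [S] into its double centralizer, then it
   stabilizes first the centralizer and then the double centralizer of [S]. *)
Lemma bicentralizes_ad g :
    (forall f, S f -> bicentralizes ((g \o f) - (f \o g))%VF) ->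
  forall f, bicentralizes f -> bicentralizes ((g \o f) - (f \o g))%VF.
Proof.
have jacobi (x y z : 'End(V)) : (y \o z = z \o y)%VF ->
    (((x \o y) - (y \o x)) \o z = z \o ((x \o y) - (y \o x)))%VF ->
    (((x \o z) - (z \o x)) \o y = y \o ((x \o z) - (z \o x)))%VF.
  move=> yzC; rewrite !(comp_lfunDl, comp_lfunDr, comp_lfunNl, comp_lfunNr).
  rewrite !comp_lfunA -(comp_lfunA x y z) -(comp_lfunA x z y) yzC => /eqP.
  rewrite subr_eq => /eqP E; apply/eqP.
  by rewrite subr_eq E addrAC [eqbRHS]addrAC (addrC (y \o x \o z)%VF).
move=> adS f Cf s Cs; apply: (jacobi); first by rewrite Cf.
symmetry; apply: Cf => h Sh; apply: (jacobi); first by rewrite Cs.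
exact: adS.
Qed.

End DoubleCentralizer.

(** * Simple Novikov algebras are fields *)

Section SimpleNovikov.
Variables (F : numFieldType) (A : vectType F) (mul : {bilinear A -> A -> A}).
Hypotheses (novikov_A : novikov mul) (simple_A : simple_algebra mul).

Definition lmul x : 'End(A) := linfun (mul x).
Definition rmul x : 'End(A) := linfun (applyr mul x).

Lemma lmulE x y : lmul x y = mul x y. Proof. exact: lfunE. Qed.
Lemma rmulE x y : rmul x y = mul y x. Proof. exact: lfunE. Qed.

Let S (f : 'End(A)) := exists x, f = rmul x.
Let C := bicentralizes S.

Lemma rmul_comm x y : (rmul x \o rmul y = rmul y \o rmul x)%VF.
Proof.
by apply/lfunP => z; rewrite !comp_lfunE !rmulE; apply: novikov_A.2.
Qed.

Let S_comm f g : S f -> S g -> (f \o g = g \o f)%VF.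
Proof. by move=> [x ->] [y ->]; apply: rmul_comm. Qed.

Let C_comm f g : C f -> C g -> (f \o g = g \o f)%VF.
Proof. exact: bicentralizes_comm. Qed.

Let C_rmul x : C (rmul x).
Proof. by apply: sub_bicentralizes; exists x. Qed.

Let C_ad x f : C f -> C ((lmul x \o f) - (f \o lmul x))%VF.
Proof.
apply: bicentralizes_ad => _ [y ->].
have -> : ((lmul x \o rmul y) - (rmul y \o lmul x))%VF
    = rmul (mul x y) - (rmul y \o rmul x)%VF.
  apply/lfunP => z; rewrite !add_lfunE !opp_lfunE !comp_lfunE !lmulE !rmulE.
  by rewrite -[LHS]opprB (novikov_A.1 x z y) opprB.
by apply: bicentralizesB; [|apply: bicentralizes_comp]; apply: C_rmul.
Qed.

Let adE x f : (lmul x \o f = f \o lmul x + ((lmul x \o f) - (f \o lmul x)))%VF.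
Proof. by rewrite addrCA subrr addr0. Qed.

Let dimA_gt0 : (0 < \dim {:A})%N.
Proof.
by have [[x x0] _ _] := simple_A; apply: dim_fullv_gt0 x0.
Qed.

Let ad_not_onto x f : C f ->
  limg ((lmul x \o f) - (f \o lmul x))%VF != fullv.
Proof.
by move=> Cf; apply: (commutator_not_onto dimA_gt0 (adE x f));
  apply: C_comm => //; apply: C_ad.
Qed.

(** Nilpotency is expressed as the absence of a nonzero [U] with [f @: U = U]; such a [U] would lie
    in the stable image, an ideal different from [A]. *)
Let not_onto_nilpotent f (U : {vspace A}) :
  C f -> limg f != fullv -> (f @: U)%VS = U -> U = 0%VS.
Proof.
move=> Cf fN fU; have [_ idealA _] := simple_A.
have [k fk] := img_iter_stable f.
have /idealA[] : two_sided_ideal mul (img_iter f k).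
- move=> x y Iy; split.
    rewrite -lmulE; apply: (img_iter_derivation (adE x f)).
      by apply: C_comm => //; apply: C_ad.
    (* Stability makes up for the power of [f] lost to [lmul x]. *)
    by rewrite /= fk.
  by rewrite -rmulE; apply: img_iter_comm => //; apply: C_comm.
- by move=> I0; apply/eqP; rewrite -subv0 -I0 sub_img_iter.
by move=> IT; case/eqP: fN; rewrite -IT.
Qed.

(* The [K] below is the common kernel of the singular elements of [C]; it is
   nonzero because a minimal nonzero [C]-invariant subspace [U] lies in it. *)
Let not_onto_eq0 f : C f -> limg f != fullv -> f = 0.
Proof.
have [_ idealA _] := simple_A.
pose invC (U : {vspace A}) := forall f, C f -> (f @: U <= U)%VS.
have [|U [invU U0] minU] := @ex_dimv_min _ A (fun U => invC U /\ U <> 0%VS) fullv.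
  split=> [g _|A0]; first exact: subvf.
  by move: dimA_gt0; rewrite A0 dimv0.
(* By commutativity of [C], the image of [U] is again invariant; were it nonzero, minimality would
   make it [U], against nilpotency. *)
have killU g : C g -> limg g != fullv -> (g @: U)%VS = 0%VS.
  move=> Cg gN; apply: contrapT => gU0; apply: U0.
  apply: (@not_onto_nilpotent g) => //; apply/eqP; rewrite eqEdim invU //=.
  apply: minU; split=> // h Ch; rewrite -limg_comp (@C_comm h g) // limg_comp.
  by apply: limgS; apply: invU.
have [||K KP] := @vspace_of_pred _ A
    (fun v => forall g, C g -> limg g != fullv -> g v = 0).
- by move=> g _ _; rewrite linear0.
- move=> a u v Pu Pv g Cg gN.
  by rewrite linearD linearZ /= (Pu g) // (Pv g) // scaler0 addr0.
have /idealA[K0|KT] : two_sided_ideal mul K.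
- move=> x y /KP Ky; split; apply/KP => g Cg gN.
    (* The bracket of [lmul x] with [g] is itself a singular element of [C], so it kills [y], and
       $g(xy) = x\,g(y) = 0$. *)
    have := ad_not_onto x Cg; move/(Ky _ (C_ad x Cg)).
    rewrite add_lfunE opp_lfunE !comp_lfunE (Ky g) // linear0 sub0r => /eqP.
    by rewrite oppr_eq0 lmulE => /eqP.
  by rewrite -rmulE -comp_lfunE C_comm // comp_lfunE (Ky g) // linear0.
- case: U0; apply/eqP; rewrite -subv0 -K0; apply/subvP => u Uu.
  apply/KP => g Cg gN; apply/eqP; rewrite -memv0 -(killU g) //.
  exact: memv_img.
move=> Cf fN; apply/lfunP => v; rewrite zero_lfunE.
by have /KP -> : v \in K by rewrite KT memvf.
Qed.

(** Associativity is the vanishing of the brackets $[L_x, R_z]$, which are singular elements of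
    [C]. *)
Lemma simple_novikov_mulA x y z : mul x (mul y z) = mul (mul x y) z.
Proof.
have /lfunP/(_ y) := not_onto_eq0 (C_ad x (C_rmul z)) (ad_not_onto x (C_rmul z)).
rewrite zero_lfunE add_lfunE opp_lfunE !comp_lfunE !lmulE !rmulE.
by move/subr0_eq.
Qed.

(** The right annihilator of [A] is an ideal. If it were [A], the product would vanish, every line
    would be an ideal, and [A] would be the excluded one-dimensional algebra. *)
Lemma simple_novikov_rmul_eq0 x : rmul x = 0 -> x = 0.
Proof.
have [[a a0] idealA nzA] := simple_A => x0.
have [||K KP] := @vspace_of_pred _ A (fun v => forall y, mul y v = 0).
- by move=> y; rewrite linear0r.
- by move=> b u v Pu Pv y; rewrite linearPr Pu Pv scaler0 addr0.
have /idealA[K0|KT] : two_sided_ideal mul K.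
- move=> y z /KP Kz; split; apply/KP => t; rewrite simple_novikov_mulA //.
  by rewrite novikov_A.2 Kz.
- by apply/eqP; rewrite -memv0 -K0; apply/KP => y; rewrite -rmulE x0 zero_lfunE.
have mul0 y z : mul y z = 0 by have /KP -> : z \in K by rewrite KT memvf.
have /idealA[/eqP|aT] : two_sided_ideal mul <[a]>%VS.
- by move=> y z _; rewrite !mul0 mem0v.
- by rewrite -subv0 -memvE memv0 (negPf a0).
by case: nzA; split=> //; rewrite -aT dim_vline a0.
Qed.

(** With associativity, the Novikov identity reads $z(xy) = z(yx)$. *)
Lemma simple_novikov_mulC x y : mul x y = mul y x.
Proof.
apply: subr0_eq; apply: simple_novikov_rmul_eq0; apply/lfunP => z.
by rewrite zero_lfunE rmulE linearBr !simple_novikov_mulA novikov_A.2 subrr.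
Qed.

Lemma simple_novikov_rmul_onto x : x != 0 -> limg (rmul x) = fullv.
Proof.
move=> x0; apply/eqP; apply: contraNT x0 => xN.
by apply/eqP/simple_novikov_rmul_eq0/not_onto_eq0.
Qed.

Lemma simple_novikov_mulf_eq0 x y : mul x y = 0 -> x != 0 -> y = 0.
Proof.
move=> xy0 /simple_novikov_rmul_onto/limg_full_lker0/lker0P; apply.
by rewrite !rmulE simple_novikov_mulC xy0 linear0l.
Qed.

Lemma simple_novikov_unit : exists2 e, e != 0 & forall x, mul e x = x.
Proof.
have [[a a0] _ _] := simple_A.
have div x : exists y, mul y a = x.
  have /memv_imgP[y _ ->] : x \in limg (rmul a).
    by rewrite simple_novikov_rmul_onto // memvf.
  by exists y; rewrite rmulE.
(* The unit solves $ea = a$; writing $x = ya$ gives $ex = y(ea) = x$. *)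
have [e ea] := div a; exists e => [|x].
  by apply: contraNneq a0 => e0; rewrite -ea e0 linear0l.
by have [y <-] := div x; rewrite simple_novikov_mulC -simple_novikov_mulA
  (simple_novikov_mulC a) ea.
Qed.

End SimpleNovikov.

(** * Real quadratic relations from complex eigenvalues, and linear bijections *)

Lemma real_mx_quadratic_factor (R : rcfType) n (M : 'M[R]_n) : (0 < n)%N ->
  exists a b, \det (M *m M - (a *+ 2) *: M + (a ^+ 2 + b ^+ 2)%:M) = 0.
Proof.
move=> n_gt0; pose toC := real_complex R.
(* The eigenvalue $a + bi$ is a root of $(X - a)^2 + b^2$, so this polynomial in [M] kills [w]; its
   determinant is already zero over [R]. *)
have [[a b] /eigenvalueP[w wM w0]] := eigenvalue_closed (map_mx toC M) n_gt0.
exists a, b; apply: (fmorph_inj toC); rewrite rmorph0 -det_map_mx.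
apply/eqP/det0P; exists w => //.
rewrite !(map_mxD, map_mxN, map_mxM, map_mxZ) map_scalar_mx.
rewrite mulmxDr mulmxBr mulmxA wM -scalemxAr -scalemxAl wM mul_mx_scalar !scalerA.
rewrite -scalerBl -scalerDl; apply/eqP; rewrite scaler_eq0 (negPf w0) orbF.
rewrite /toC /= /real_complex_def eq_complex /=; apply/andP; split; apply/eqP; ring.
Qed.

Lemma real_lfun_quadratic (R : rcfType) (V : vectType R) (f : 'End(V)) :
    (0 < \dim {:V})%N ->
  exists a b v, v != 0 /\ f (f v) - (a *+ 2) *: f v + (a ^+ 2 + b ^+ 2) *: v = 0.
Proof.
move=> V_gt0; pose e := vbasis {:V}; have eV : basis_of {:V} e by exact: vbasisP.
have [a [b /eqP/det0P[w w0 wM]]] := real_mx_quadratic_factor (mxof e e f) V_gt0.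
exists a, b, (vecof e w); split.
  by rewrite vecof_eq0 // (basis_free eV).
have := congr1 (vecof e) wM.
rewrite mulmxDr mulmxBr mulmxA -scalemxAr mul_mx_scalar.
by rewrite linear0 linearD linearB !linearZ /= -!(hom_vecof e eV).
Qed.

Lemma algebra_isomorphic_sym (F : fieldType) (A B : vectType F)
    (mulA : A -> A -> A) (mulB : B -> B -> B) :
  algebra_isomorphic mulA mulB -> algebra_isomorphic mulB mulA.
Proof.
move=> [f [g fK gK] fM].
pose gL := GRing.isLinear.Build F B A _ g (can2_linear fK gK).
pose h : {linear B -> A} := HB.pack g gL.
exists h; first by exists f.
by move=> x y; rewrite /= -[RHS]fK fM !gK.
Qed.

Lemma linear_bij (F : fieldType) (A B : lmodType F) (f : {linear A -> B}) :
  (forall x, f x = 0 -> x = 0) -> (forall y, exists x, f x = y) -> bijective f.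
Proof.
move=> f_inj /choice[g gK]; exists g => // x.
by apply: subr0_eq; apply: f_inj; rewrite linearB gK subrr.
Qed.

(** * Simple Novikov algebras over a real closed field *)

Section RealSimpleNovikov.
Variables (R : rcfType) (A : vectType R) (mul : {bilinear A -> A -> A}).
Hypotheses (novikov_A : novikov mul) (simple_A : simple_algebra mul).
Variable e : A.
Hypotheses (e0 : e != 0) (mul1 : forall x, mul e x = x).

Let mulC x y : mul x y = mul y x.
Proof. exact: simple_novikov_mulC. Qed.

Let mulr1 x : mul x e = x.
Proof. by rewrite mulC mul1. Qed.

Let mulZZ c x : mul (c *: x) (c *: x) = c ^+ 2 *: mul x x.
Proof. by rewrite linearZl_LR linearZr_LR /= scalerA. Qed.

Let mul_addsub x y : mul (x + y) (x - y) = mul x x - mul y y.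
Proof. by rewrite linearDl !linearBr (mulC y x) addrA subrK. Qed.

Lemma simple_novikov_neg_square x :
  exists a b, mul (x - a *: e) (x - a *: e) = - (b ^+ 2 *: e).
Proof.
have [a [b [v [v0]]]] := real_lfun_quadratic (rmul mul x) (dim_fullv_gt0 e0).
rewrite !rmulE -(simple_novikov_mulA novikov_A simple_A) => vE.
(* The product of [v] with this element is zero, and there are no zero divisors. *)
have xE : mul x x - (a *+ 2) *: x + (a ^+ 2 + b ^+ 2) *: e = 0.
  apply: (simple_novikov_mulf_eq0 novikov_A simple_A) v0.
  by rewrite linearDr linearBr !linearZr_LR /= mulr1.
exists a, b; apply/eqP; rewrite -addr_eq0 -xE; apply/eqP.
rewrite linearBl !linearBr !linearZl_LR !linearZr_LR /= !mul1 mulr1.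
by rewrite scalerDl mulr2n scalerDl scalerA -expr2 !opprD opprK !addrA.
Qed.

Lemma simple_novikov_real_or_complex :
  (forall x, exists a, x = a *: e) \/ exists j, mul j j = - e.
Proof.
have [|/existsNP[x xN]] := pselect (forall x, exists a, x = a *: e); first by left.
right; have [a [b xE]] := simple_novikov_neg_square x.
have [b0|b0] := eqVneq b 0.
  case: xN; exists a; apply: subr0_eq.
  move: xE; rewrite b0 expr0n scale0r oppr0 => xE; apply/eqP/negPn/negP => x0.
  by move/eqP: (x0); apply; apply: (simple_novikov_mulf_eq0 novikov_A simple_A xE).
(* Rescaling turns the square $-b^2 e$ into $-e$. *)
exists (b^-1 *: (x - a *: e)); rewrite mulZZ xE scalerN scalerA -exprMn.
by rewrite mulVf // expr1n scale1r.
Qed.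

Section Complex.
Variable j : A.
Hypothesis jj : mul j j = - e.

Lemma simple_novikov_complex_span y : exists c d, y = c *: e + d *: j.
Proof.
have [c [d yE]] := simple_novikov_neg_square y.
(* Both $y - ce$ and $dj$ have square $-d^2 e$, so a difference of squares factors and one factor
   vanishes. *)
have : mul (y - c *: e + d *: j) (y - c *: e - d *: j) = 0.
  by rewrite mul_addsub yE mulZZ jj scalerN opprK addNr.
have [/eqP|yN /(simple_novikov_mulf_eq0 novikov_A simple_A)/(_ yN)/eqP] :=
  eqVneq (y - c *: e + d *: j) 0.
  rewrite addr_eq0 subr_eq => /eqP -> _; exists c, (- d).
  by rewrite scaleNr addrC.
by rewrite !subr_eq add0r => /eqP ->; exists c, d; rewrite addrC.
Qed.

Lemma simple_novikov_complex_free c d : c *: e + d *: j = 0 -> c = 0 /\ d = 0.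
Proof.
(* Multiplying by the conjugate gives $(c^2 + d^2)e = 0$. *)
move=> cd0; have := linear0l mul (c *: e - d *: j).
rewrite -cd0 mul_addsub !mulZZ mul1 jj cd0 scalerN opprK -scalerDl => /eqP.
rewrite scaler_eq0 (negPf e0) orbF paddr_eq0 ?sqr_ge0 // !sqrf_eq0.
by case/andP => /eqP -> /eqP ->.
Qed.

End Complex.

End RealSimpleNovikov.

(** * The classification *)

Theorem theorem33 (R : realType) (A : vectType R)
    (mul : {bilinear A -> A -> A})
    (novikov_A : novikov mul) (simple_A : simple_algebra mul) :
  algebra_isomorphic mul (@A2_mul R) \/ algebra_isomorphic mul (@field_mul R).
Proof.
have [e e0 mul1] := simple_novikov_unit novikov_A simple_A.
have mulr1 x : mul x e = x by rewrite (simple_novikov_mulC novikov_A simple_A).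
have [realA|[j jj]] := simple_novikov_real_or_complex novikov_A simple_A e0 mul1.
  right; apply: algebra_isomorphic_sym.
  pose f (c : R^o) : A := c *: e.
  have f_lin : linear f by move=> a u v; rewrite /f scalerDl scalerA.
  pose fL : {linear R^o -> A} := HB.pack f (GRing.isLinear.Build R R^o A _ f f_lin).
  exists fL => [|x y].
    apply: linear_bij => [c /eqP|y]; last by have [c ->] := realA y; exists c.
    by rewrite scaler_eq0 (negPf e0) orbF => /eqP.
  by rewrite /= /f linearZl_LR mul1 /= scalerA.
left; apply: algebra_isomorphic_sym.
(* The map goes from the model to [A], where it is explicit: $e_1 \mapsto e$, $e_2 \mapsto j$. *)
pose f (v : 'rV[R]_2) : A := v 0 0 *: e + v 0 1 *: j.
have f_lin : linear f.
  by move=> a u v; rewrite /f !mxE !scalerDl scalerDr !scalerA addrACA.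
pose fL : {linear 'rV[R]_2 -> A} :=
  HB.pack f (GRing.isLinear.Build R 'rV[R]_2 A _ f f_lin).
exists fL => [|x y].
  apply: linear_bij => [v|y].
    move=> /(simple_novikov_complex_free novikov_A simple_A e0 mul1 jj)[v0 v1].
    apply/rowP => i; rewrite mxE; case: (unliftP 0 i) => [k|] ->; last exact: v0.
    by rewrite (ord1 k) -[RHS]v1; congr (v _ _); apply: val_inj.
  have [c [d ->]] := simple_novikov_complex_span novikov_A simple_A e0 mul1 jj y.
  exists (c *: A2_e1 R + d *: A2_e2 R).
  by rewrite /= /f !mxE /= !mulr1n !mulr0n !mulr0 !GRing.mulr1 addr0 add0r.
have ord1E : lift ord0 ord0 = 1 :> 'I_2 by apply: val_inj.
(* These are the real and imaginary parts of a product of complex numbers. *)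
have zE : (A2_mul x y 0 0 = x 0 0 * y 0 0 - x 0 1 * y 0 1) *
          (A2_mul x y 0 1 = x 0 0 * y 0 1 + x 0 1 * y 0 0).
  by split; rewrite /A2_mul !big_ord_recl !big_ord0 !ord1E /A2_table !mxE /=;
    ring.
rewrite /= /f !zE linearDl !linearDr !linearZl_LR !linearZr_LR /= !mul1.
rewrite mulr1 jj !scalerA scalerN !scalerDl scaleNr.
by rewrite -!addrA; congr (_ + _); rewrite addrC -addrA.
Qed.
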